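(* Let $p$ be a prime, let $H\in[1,p)$ be an integer, and let $\mathcal{M}\subseteq \mathbb{F}_p^*$ be a set of cardinality $M$. Let $J(H,\mathcal{M})$ denote the number of quadruples $(x,y,m,n)$ with integers $x,y\in[1,H]$ and $m,n\in\mathcal{M}$ such that $xm\equiv yn \pmod p$. Then, as $p\to\infty$, $$ J(H,\mathcal{M})\ll\begin{cases} H^2M^2 p^{-1} + H Mp^{o(1)} &\text{if } H\ge p^{2/3},\\ H^2M^2p^{-1}+HM^{7/4}p^{-1/4+o(1)}+M^2 &\text{if } H<p^{2/3} \text{ and } M\ge p^{1/3},\\ HMp^{o(1)}+M^2 &\text{if } H<p^{2/3} \text{ and } M<p^{1/3}. \end{cases} $$
   Context: $\mathbb{F}_p$ is the field with $p$ elements, identified with $\{0,1,\ldots,p-1\}$, and $\mathbb{F}_p^*=\mathbb{F}_p\setminus\{0\}$. The notation $U\ll V$ means $|U|\le cV$ for an absolute constant $c>0$. A factor $p^{o(1)}$ denotes a quantity $f(p)$ with $\log|f(p)|/\log p\to 0$ as $p\to\infty$, uniformly in $H$ and $\mathcal{M}$. *)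

(* Defs.v *)
From mathcomp Require Export all_boot all_order all_algebra.
From mathcomp Require Export all_classical all_reals all_analysis.
Import Order.TTheory GRing.Theory Num.Theory.
Import numFieldNormedType.Exports.

Set Implicit Arguments.
Unset Strict Implicit.
Unset Printing Implicit Defensive.

Local Open Scope classical_set_scope.
Local Open Scope ring_scope.

Definition primes_oo : set_system nat := within [set p : nat | prime p] \oo.

(* f is a factor of the form p^{o(1)}. Nonvanishing is required explicitly,
   because the library convention is ln 0 = 0. *)
Definition is_p_to_o1 (R : realType) (f : nat -> R) : Prop :=
  (\forall p \near primes_oo, f p != 0) /\
  (ln `|f p| / ln p%:R @[p --> primes_oo] --> (0 : R)).

(* The integers of [1, H] are the nonzero elements of 'I_H.+1; an element of
   'F_p coerces to its representative in {0, ..., p-1} when p is prime. *)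
Definition J (p H : nat) (M : {set 'F_p}) : nat :=
  #|[set q : 'I_H.+1 * 'I_H.+1 * 'F_p * 'F_p |
      let: (x, y, m, n) := q in
      [&& (0 < x)%N, (0 < y)%N, m \in M, n \in M &
          (x * m == y * n %[mod p])%N]]%SET|.

(* Main.v *)
Require Import Defs.
From mathcomp Require Import zify ring lra.
Import Order.TTheory GRing.Theory Num.Theory.
Import numFieldNormedType.Exports.

Set Implicit Arguments.
Unset Strict Implicit.
Unset Printing Implicit Defensive.

(* Call m and n near at scale S if x m = y n for some x, y in [1, S], and let
   E(S) be the number of near pairs of elements of M. Two ingredients:
   - if (a, b) is a primitive solution of x m = y n of sup norm s, then the
     solutions in [1, H]^2 lie on at most 2 H s / p + 1 lines parallel to (a, b),
     hence number at most 4 H^2 / p + 2 H / s. Summing over m, n dyadically in s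
     bounds J(H) by H^2 M^2 / p plus H times the rate max_S E(S) / S, up to a
     logarithm;
   - by Cauchy-Schwarz, E(S)^2 is at most M times the number of two-step paths
     m - n - m'. Such a path gives x y' m = y x' m', so the divisor bound yields
     E(S)^2 <= M tau^2 J(S^2).
   Together they make the rate g over S <= p^(1/3) satisfy
   g^2 << M tau^2 (M^2 / p^(1/3) + tau g), which bounds g. This gives the theorem
   when H >= p^(2/3) or M < p^(1/3). In the remaining case the same recursion,
   combined with the trivial bound E(S) <= M^2, controls E(S) / S for all
   S <= p^(1/2). The factor p^o(1) is the fourth power of
   tau(p) = max_(n <= p) d(n), which also dominates the logarithm. *)

Local Open Scope nat_scope.

(** * The divisor bound *)

(** A divisor d of a b is gcd(d, a) times a cofactor that divides b, so products of a divisor of a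
    and a divisor of b cover all divisors of a b. *)
Lemma size_divisorsM a b : 0 < a -> 0 < b ->
  size (divisors (a * b)) <= size (divisors a) * size (divisors b).
Proof.
move=> a0 b0; rewrite -(size_allpairs muln).
apply: uniq_leq_size (divisors_uniq _) _ => d.
rewrite -dvdn_divisors ?muln_gt0 ?a0 // => dab.
have g0 : 0 < gcdn d a by rewrite gcdn_gt0 a0 orbT.
have ed : d = gcdn d a * (d %/ gcdn d a) by rewrite muln_divA ?dvdn_gcdl ?mulKn.
rewrite ed allpairs_f // -dvdn_divisors ?dvdn_gcdr //.
have /Gauss_dvdr <- : coprime (d %/ gcdn d a) (a %/ gcdn d a).
  rewrite /coprime -(eqn_pmul2l g0) muln1 muln_gcdr -ed.
  by rewrite muln_divA ?dvdn_gcdr ?mulKn.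
by rewrite -(dvdn_pmul2l g0) -ed mulnA muln_divA ?dvdn_gcdr // mulKn.
Qed.

Lemma size_divisorsX q e : prime q -> size (divisors (q ^ e)) = e.+1.
Proof.
move=> q_pr; have q1 := prime_gt1 q_pr.
rewrite -[RHS](size_iota 0) -[RHS](size_map (expn q)); apply/perm_size/uniq_perm.
- exact: divisors_uniq.
- by rewrite map_inj_uniq ?iota_uniq //; apply: expnI.
move=> d; rewrite -dvdn_divisors ?expn_gt0 ?prime_gt0 //.
apply/dvdn_pfactor/mapP => // -[i]; first by move=> ie ->; exists i; rewrite ?mem_iota.
by rewrite mem_iota add0n ltnS => /andP[_ ie] ->; exists i.
Qed.

Lemma size_divisors_prod (I : Type) (s : seq I) (F : I -> nat) :
  (forall i, 0 < F i) ->
  size (divisors (\prod_(i <- s) F i)) <= \prod_(i <- s) size (divisors (F i)).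
Proof.
move=> F0; elim: s => [|i s IHs]; first by rewrite !big_nil.
rewrite !big_cons; apply: leq_trans (size_divisorsM _ _) _ => //.
  by apply: prodn_gt0.
by rewrite leq_mul2l IHs orbT.
Qed.

(** Raise e + 1 <= k (e %/ k + 1) <= k 2 ^ (e %/ k) to the k-th power. *)
Lemma expSn_le_exp2 k e : 0 < k -> e.+1 ^ k <= k ^ k * 2 ^ e.
Proof.
move=> k0.
have h : e.+1 <= k * 2 ^ (e %/ k).
  apply: (@leq_trans (k * (e %/ k).+1)).
    by rewrite mulnC; apply: ltn_ceil.
  by rewrite leq_mul2l (ltn_expl _ (isT : 1 < 2)) orbT.
apply: (@leq_trans ((k * 2 ^ (e %/ k)) ^ k)); first by rewrite leq_exp2r.
by rewrite expnMn leq_mul2l -expnM leq_exp2l // leq_trunc_div orbT.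
Qed.

(* A prime q >= 2 ^ k satisfies (e + 1) ^ k <= q ^ e, so only the boundedly
   many smaller primes contribute to the constant. *)
Lemma size_divisors_le k n : 0 < k -> 0 < n ->
  size (divisors n) ^ k <= (k ^ k) ^ (2 ^ k) * n.
Proof.
move=> k0 n0.
have kk0 : 0 < k ^ k by rewrite expn_gt0 k0.
pose c q := if q < 2 ^ k then k ^ k else 1.
have cP q e : prime q -> e.+1 ^ k <= c q * q ^ e.
  move=> q_pr; rewrite /c; case: ltnP => hq.
    apply: leq_trans (expSn_le_exp2 _ k0) _; rewrite leq_mul2l.
    case: e => [|e]; first by rewrite !expn0 orbT.
    by rewrite leq_exp2r // prime_gt1 // orbT.
  rewrite mul1n; apply: (@leq_trans ((2 ^ e) ^ k)).
    by rewrite leq_exp2r // ltn_expl.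
  rewrite -expnM mulnC expnM.
  by case: e => [|e]; [rewrite !expn0 | rewrite leq_exp2r].
have -> : (k ^ k) ^ (2 ^ k) * n =
    (k ^ k) ^ (2 ^ k) * \prod_(f <- prime_decomp n) pfactor f.1 f.2.
  by rewrite -prod_prime_decomp.
have hd : size (divisors n) <= \prod_(f <- prime_decomp n) f.2.+1.
  rewrite [in X in X <= _](prod_prime_decomp n0) (big_nth (0, 0)).
  rewrite [X in _ <= X](big_nth (0, 0)) !big_mkord.
  pose F (i : 'I_(size (prime_decomp n))) :=
    let f := nth (0, 0) (prime_decomp n) i in f.1 ^ f.2.
  have Fpr (i : 'I_(size (prime_decomp n))) :
      prime (nth (0, 0) (prime_decomp n) i).1.
    have := mem_nth (0, 0) (ltn_ord i).
    by case: nth => q e /mem_prime_decomp[].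
  apply: leq_trans (@size_divisors_prod _ _ F _) _.
    by move=> i; rewrite expn_gt0 prime_gt0.
  by apply: leq_prod => i _; rewrite /F size_divisorsX.
apply: (@leq_trans ((\prod_(f <- prime_decomp n) f.2.+1) ^ k)).
  by rewrite leq_exp2r.
(* The primes of n are distinct, so at most 2 ^ k of them lie below 2 ^ k. *)
have hc : \prod_(f <- prime_decomp n) c f.1 <= (k ^ k) ^ (2 ^ k).
  rewrite -(big_map fst xpredT c) -/(primes n).
  rewrite /c -big_mkcond /= big_const_seq iter_muln_1.
  rewrite leq_pexp2l // -size_filter -[leqRHS](size_iota 0).
  apply: uniq_leq_size; first by rewrite filter_uniq // primes_uniq.
  by move=> q; rewrite mem_filter mem_iota => /andP[/= ->].
apply: leq_trans (leq_mul hc (leqnn _)).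
rewrite -big_split /= !big_seq.
apply: (big_ind2 (fun x y => x ^ k <= y)) => [|a1 a2 b1 b2 h1 h2|[q e]].
- by rewrite exp1n.
- by rewrite expnMn leq_mul.
by case/mem_prime_decomp => q_pr _ _; apply: cP.
Qed.

Definition tau p := \max_(n < p.+1) size (divisors n).

Lemma size_divisors_tau p n : n <= p -> size (divisors n) <= tau p.
Proof. by move=> np; apply: (leq_bigmax (Ordinal (np : n < p.+1))). Qed.

Lemma tau_gt0 p : 0 < tau p.
(* By convention [divisors 0] has one element, so n = 0 already witnesses positivity. *)
Proof. exact: leq_trans (size_divisors_tau (leq0n p)). Qed.

(** The largest power of 2 up to p has [trunc_log 2 p] + 1 divisors. This is how [tau p] absorbs the
    number of dyadic scales. *)
Lemma trunc_log2_tau p : 0 < p -> trunc_log 2 p < tau p.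
Proof.
move=> p0; rewrite -(@size_divisorsX 2) //.
by apply: size_divisors_tau; apply: trunc_logP.
Qed.

Lemma tau_le k p : 0 < k -> 0 < p -> tau p ^ k <= (k ^ k) ^ (2 ^ k) * p.
Proof.
move=> k0 p0; have [n ->] : exists n : 'I_p.+1, tau p = size (divisors n).
  by have [//|n _ h] := @eq_bigmax_cond 'I_p.+1 predT
       (fun n => size (divisors n)); [rewrite card_ord | exists n].
have [->|n0] := posnP n.
  by rewrite exp1n muln_gt0 p0 !expn_gt0 k0.
apply: leq_trans (size_divisors_le k0 n0) _.
by rewrite leq_mul2l -ltnS ltn_ord orbT.
Qed.

(** * Counting the solutions of x m = y n for fixed m and n *)

Lemma eqn_modMl_coprime p g u v : coprime p g ->
  (g * u == g * v %[mod p]) = (u == v %[mod p]).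
Proof.
move=> pg; wlog uv : u v / u <= v => [hw|].
  by case: (leqP u v) => [/hw//|/ltnW/hw]; rewrite eq_sym => ->; rewrite eq_sym.
rewrite eq_sym [in RHS]eq_sym !eqn_mod_dvd ?leq_mul2l ?uv ?orbT //.
by rewrite -mulnBr Gauss_dvdr.
Qed.

(** Positivity belongs to the relation because the sums below run over ordinals, which contain 0. *)
Definition cong p m n x y := [&& 0 < x, 0 < y & x * m == y * n %[mod p]].

Definition near p S m n := [exists x : 'I_S.+1, exists y : 'I_S.+1, cong p m n x y].

Definition nsol p H m n := \sum_(x < H.+1) \sum_(y < H.+1) cong p m n x y.

Lemma congC p m n x y : cong p m n x y = cong p n m y x.
Proof. by rewrite /cong eq_sym andbCA. Qed.

Lemma nearP p S m n :
  reflect (exists x y, [/\ x <= S, y <= S & cong p m n x y]) (near p S m n).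
Proof.
apply: (iffP existsP) => [[x /existsP[y c]]|[x [y [xS yS c]]]].
  by exists x, y; split=> //; rewrite -ltnS.
by exists (Ordinal (xS : x < S.+1)); apply/existsP; exists (Ordinal (yS : y < S.+1)).
Qed.

Lemma nearS p S T m n : S <= T -> near p S m n -> near p T m n.
Proof.
move=> ST /nearP[x [y [xS yS c]]]; apply/nearP; exists x, y.
by split=> //; apply: leq_trans ST.
Qed.

Lemma nsolC p H m n : nsol p H m n = nsol p H n m.
Proof.
rewrite /nsol exchange_big; apply: eq_bigr => x _; apply: eq_bigr => y _.
by rewrite congC.
Qed.

(** After multiplication by the unit m n, both sides become (y n) (a m). *)
Lemma cong_det p m n x y a b : coprime p m -> coprime p n ->
  cong p m n x y -> cong p m n a b -> x * b == y * a %[mod p].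
Proof.
move=> pm pn /and3P[_ _ /eqP e1] /and3P[_ _ /eqP e2].
rewrite -(@eqn_modMl_coprime _ (m * n)) ?coprimeMr ?pm //.
have -> : m * n * (x * b) = (x * m) * (b * n).
  by rewrite mulnACA [x * m]mulnC [b * n]mulnC.
have -> : m * n * (y * a) = (y * n) * (a * m).
  by rewrite [m * n]mulnC mulnACA [y * n]mulnC [a * m]mulnC.
by rewrite -modnMml e1 modnMml -modnMmr -e2 modnMmr.
Qed.

(* The solutions lie on lines parallel to (a, b), indexed by a determinant
   divisible by p; on each line they are spaced by multiples of (a, b). *)
Lemma nsol_le_primitive p H m n a b : coprime p m -> coprime p n -> 0 < p ->
  cong p m n a b -> coprime a b -> b <= a ->
  nsol p H m n <= ((2 * H * a) %/ p).+1 * (H %/ a).+1.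
Proof.
move=> pm pn p0 cab ab ba.
have a0 : 0 < a by case/and3P: cab.
pose A := [set z : 'I_H.+1 * 'I_H.+1 | cong p m n z.1 z.2].
have -> : nsol p H m n = #|A|.
  by rewrite /nsol pair_bigA /= -sum1dep_card [RHS]big_mkcond.
(* The determinant x b - y a shifted by H a: it stays a natural number, and is at most 2 H a because
   b <= a. *)
pose D (z : 'I_H.+1 * 'I_H.+1) := z.1 * b + (H - z.2) * a.
pose f z : 'I_((2 * H * a) %/ p).+1 * 'I_(H %/ a).+1 :=
  (inord (D z %/ p), inord (z.1 %/ a)).
have leH (i : 'I_H.+1) : i <= H by rewrite -ltnS.
have f_inj : {in A &, injective f}.
  move=> [x y] [x' y']; rewrite !inE /= => c c'.
  have hD z : D z %/ p < ((2 * H * a) %/ p).+1.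
    rewrite ltnS leq_div2r // /D.
    apply: (@leq_trans (H * a + H * a)); last by lia.
    by rewrite leq_add ?leq_mul ?leq_subr.
  have hx (z : 'I_H.+1) : z %/ a < (H %/ a).+1 by rewrite ltnS leq_div2r.
  rewrite /f => -[/(congr1 val) + /(congr1 val)]; rewrite /= !inordK // => eD ex.
  have DH z : z \in A -> D z = H * a %[mod p].
    rewrite inE => cz; rewrite /D -modnDml.
    rewrite (eqP (cong_det pm pn cz cab)) modnDml -mulnDl subnKC //.
  have {}eD : D (x, y) = D (x', y').
    by rewrite (divn_eq (D _) p) eD DH ?inE // -(DH (x', y')) ?inE // -divn_eq.
  have e : x * b + y' * a = x' * b + y * a.
    have h1 : (H - y) * a + y * a = H * a by rewrite -mulnDl subnK.
    have h2 : (H - y') * a + y' * a = H * a by rewrite -mulnDl subnK.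
    by move: eD h1 h2; rewrite /D /=; lia.
  (* Modulo a the equation [e] reads x b = x' b with b invertible; the quotients by a agree
     already. *)
  have exx : x = x' :> nat.
    rewrite (divn_eq x a) (divn_eq x' a) ex; congr (_ + _); apply/eqP.
    rewrite -(@eqn_modMl_coprime _ b) // ![b * _]mulnC.
    by rewrite -(modnMDl y' (x * b)) -(modnMDl y (x' * b)) addnC e addnC.
  have eyy : y = y' :> nat.
    apply/eqP; rewrite -(eqn_pmul2r a0); apply/eqP.
    by move: e; rewrite exx => /addnI.
  by congr (_, _); apply: val_inj.
rewrite -(card_in_imset f_inj).
by apply: leq_trans (max_card _) _; rewrite card_prod !card_ord.
Qed.

Lemma coprime_lt p x : prime p -> 0 < x < p -> coprime p x.
Proof.
move=> p_pr /andP[x0 xp]; rewrite prime_coprime //.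
by apply: contraL xp => /dvdn_leq -/(_ x0); rewrite -leqNgt.
Qed.

(** The gcd of x and y is at most x < p, hence a unit modulo p that can be cancelled. *)
Lemma cong_primitive p m n x y : prime p -> x < p -> cong p m n x y ->
  exists a b, [/\ a <= x, b <= y, coprime a b & cong p m n a b].
Proof.
move=> p_pr xp /and3P[x0 y0 e]; set g := gcdn x y.
have g0 : 0 < g by rewrite gcdn_gt0 x0.
have [gx gy] : g %| x /\ g %| y by rewrite dvdn_gcdl dvdn_gcdr.
exists (x %/ g), (y %/ g); rewrite !leq_div /cong !divn_gt0 //.
rewrite (dvdn_leq x0 gx) (dvdn_leq y0 gy); split=> //=.
  by rewrite /coprime -(eqn_pmul2l g0) muln_gcdr ![g * (_ %/ _)]mulnC !divnK // muln1.
rewrite -(@eqn_modMl_coprime _ g) ?mulnA ?[g * (_ %/ _)]mulnC ?divnK //.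
by rewrite coprime_lt // g0 (leq_ltn_trans (dvdn_leq x0 gx)).
Qed.

(** Here s is the sup norm of a primitive solution below any given one; m and n are exchanged when
    its second entry is the larger. *)
Lemma nsol_le p H m n : prime p -> coprime p m -> coprime p n -> H < p ->
  0 < nsol p H m n ->
  exists s, [/\ 0 < s, s <= H, near p s m n &
    nsol p H m n <= ((2 * H * s) %/ p).+1 * (H %/ s).+1].
Proof.
move=> p_pr pm pn Hp; rewrite lt0n sum_nat_eq0 negb_forall => /existsP[x].
rewrite sum_nat_eq0 negb_forall => /existsP[y]; rewrite eqb0 negbK => cxy.
have xp : x < p by rewrite (leq_ltn_trans _ Hp) // -ltnS.
have [a [b [ax bx ab cab]]] := cong_primitive p_pr xp cxy.
have aH : a <= H by rewrite (leq_trans ax) // -ltnS.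
have bH : b <= H by rewrite (leq_trans bx) // -ltnS.
have /and3P[a0 b0 _] := cab; have p0 := prime_gt0 p_pr.
have [ba|/ltnW ba] := leqP b a.
  exists a; split=> //; first by apply/nearP; exists a, b.
  exact: nsol_le_primitive cab ab ba.
exists b; split=> //; first by apply/nearP; exists a, b.
rewrite nsolC; apply: (@nsol_le_primitive _ _ _ _ b a) => //.
  by rewrite -congC.
by rewrite coprime_sym.
Qed.

(** * Near pairs and two-step paths *)

(** A positive A is a product x y in at most [tau p] ways, since x divides A and determines y. This
    fails for A = 0, whence the condition g 0 = 0. *)
Lemma sum_products_le p S (g : nat -> nat) : S ^ 2 <= p -> g 0 = 0 ->
  \sum_(x < S.+1) \sum_(y < S.+1) g (x * y)
    <= tau p * \sum_(A < (S ^ 2).+1) g A.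
Proof.
move=> Sp g0.
have -> : \sum_(x < S.+1) \sum_(y < S.+1) g (x * y) =
    \sum_(A < (S ^ 2).+1) \sum_(z : 'I_S.+1 * 'I_S.+1 | z.1 * z.2 == A) g A.
  rewrite pair_bigA /= (exchange_big_dep xpredT) //=; apply: eq_bigr => -[x y] _ /=.
  have xyS : x * y < (S ^ 2).+1 by rewrite ltnS expnS expn1 leq_mul // -ltnS.
  by rewrite (big_pred1 (Ordinal xyS)) // => A; rewrite -val_eqE eq_sym.
rewrite big_distrr /=; apply: leq_sum => A _.
rewrite sum_nat_cond_const leq_mul2r; have [//|/= gA0] := posnP (g A).
have [A0|A0] := posnP A; first by rewrite A0 g0 in gA0.
apply: leq_trans (size_divisors_tau (_ : A <= p)); last first.
  by rewrite (leq_trans _ Sp) // -ltnS.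
pose f (z : 'I_S.+1 * 'I_S.+1) := z.1 : nat.
rewrite cardE -(size_map f); apply: uniq_leq_size => [|d].
  rewrite map_inj_in_uniq ?enum_uniq // => -[x y] [x' y'].
  rewrite !mem_enum !inE /= /f /= => /eqP e /eqP e' exx.
  have x0 : 0 < x by move: A0; rewrite -e muln_gt0 => /andP[].
  have /eqP : x * y = x * y' by rewrite e exx e'.
  by rewrite eqn_pmul2l // => /eqP eyy; congr (_, _); apply: val_inj.
case/mapP => -[x y]; rewrite mem_enum inE /= => /eqP e ->.
by rewrite -dvdn_divisors // -e dvdn_mulr.
Qed.

Definition near_pairs p S (M : {set 'F_p}) :=
  \sum_(m in M) \sum_(n in M) near p S m n.

Lemma J_nsol p H (M : {set 'F_p}) :
  J H M = \sum_(m in M) \sum_(n in M) nsol p H m n.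
Proof.
rewrite /J -sum1dep_card big_mkcond /=.
pose F (q : 'I_H.+1 * 'I_H.+1) (r : 'F_p * 'F_p) : nat :=
  [&& r.1 \in M, r.2 \in M & cong p r.1 r.2 q.1 q.2].
transitivity (\sum_q \sum_m \sum_n F q (m, n)).
  rewrite !pair_bigA /=; apply: eq_bigr => -[[[x y] m] n] _ /=.
  by rewrite /F /cong /=; case: (m \in M); case: (n \in M); rewrite ?andbF //=.
under eq_bigr => q _ do rewrite pair_bigA /=.
rewrite exchange_big [RHS]pair_big [RHS]big_mkcond /=.
apply: eq_bigr => -[m n] _ /=; rewrite /F /= /nsol pair_bigA /=.
by case: (m \in M); case: (n \in M) => //=; rewrite big1.
Qed.

Lemma Fp_coprime p (m : 'F_p) : prime p -> m != 0%R -> coprime p m.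
Proof.
move=> p_pr m0; apply: coprime_lt => //; rewrite lt0n; apply/andP; split.
  by apply: contra m0 => /eqP e; apply/eqP/val_inj.
by have := ltn_ord m; rewrite [X in _ < X -> _]Fp_cast.
Qed.

Lemma cong_inj p S m x y (n n' : 'F_p) : prime p -> S < p -> y <= S ->
  cong p m n x y -> cong p m n' x y -> n = n'.
Proof.
move=> p_pr Sp yS /and3P[x0 y0 /eqP e] /and3P[_ _ /eqP]; rewrite e => /eqP.
rewrite eqn_modMl_coprime; last by rewrite coprime_lt // y0 (leq_ltn_trans yS).
have lt (k : 'F_p) : k < p by have := ltn_ord k; rewrite [X in _ < X -> _]Fp_cast.
by rewrite !modn_small ?lt // => /eqP ?; apply: val_inj.
Qed.

Lemma near_le_nsol p S m n : near p S m n <= nsol p S m n.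
Proof.
case E: near => //; have /existsP[x /existsP[y c]] := E.
by rewrite /nsol (bigD1 x) //= (bigD1 y) //= c.
Qed.

(** From x m = y n and x' m' = y' n follows (x y') m = (y x') m'. The four coefficients determine n
    by [cong_inj], and grouping them by the products x y' and y x' costs one factor [tau p] each. *)
Lemma common_neighbours_le p S (M : {set 'F_p}) (m m' : 'F_p) :
  prime p -> S ^ 2 < p ->
  \sum_(n in M) near p S m n * near p S m' n <= tau p ^ 2 * nsol p (S ^ 2) m m'.
Proof.
move=> p_pr Sp.
have S_lt : S < p.
  by apply: leq_ltn_trans Sp; case: (S) => // k; rewrite expnS leq_pmulr.
pose g A B : nat := cong p m m' A B.
apply: (@leq_trans (\sum_(x < S.+1) \sum_(y' < S.+1) \sum_(y < S.+1) \sum_(x' < S.+1)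
    g (x * y') (y * x'))).
  apply: (@leq_trans (\sum_(n in M) \sum_(x < S.+1) \sum_(y' < S.+1)
      \sum_(y < S.+1) \sum_(x' < S.+1) cong p m n x y * cong p m' n x' y')).
    apply: leq_sum => n _.
    apply: leq_trans (leq_mul (near_le_nsol _ _ _ _) (near_le_nsol _ _ _ _)) _.
    rewrite /nsol big_distrl eq_leq //; apply: eq_bigr => x _.
    rewrite [RHS]exchange_big big_distrl /=; apply: eq_bigr => y _.
    rewrite [RHS]exchange_big big_distrr /=; apply: eq_bigr => x' _.
    by rewrite big_distrr.
  rewrite exchange_big; apply: leq_sum => x _.
  rewrite exchange_big; apply: leq_sum => y' _.
  rewrite exchange_big; apply: leq_sum => y _.
  rewrite exchange_big; apply: leq_sum => x' _ /=.
  have [/existsP[n0 /and3P[n0M c0 c0']]|/existsPn h] :=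
    boolP [exists n, [&& n \in M, cong p m n x y & cong p m' n x' y']].
    rewrite (bigD1 n0) //= c0 c0' big1 => [|n /andP[nM nn0]].
      rewrite addn0 muln1 /g; case/and3P: c0 => x0 y0 /eqP e.
      case/and3P: c0' => x0' y0' /eqP e'.
      rewrite /cong !muln_gt0 x0 y0 x0' y0' /= lt0b; apply/eqP.
      rewrite -mulnA mulnCA -modnMmr e modnMmr [y' * _]mulnCA -mulnA.
      by rewrite -[in RHS]modnMmr e' modnMmr.
    case c: (cong p m n x y) => //; case/eqP: nn0.
    by apply: (cong_inj p_pr S_lt _ c c0); rewrite -ltnS.
  rewrite big1 // => n nM; have := h n; rewrite nM /=.
  by do 2!case: cong.
have g0 A B : (A == 0) || (B == 0) -> g A B = 0.
  by rewrite /g /cong; case: A => //; case: B.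
pose G A := \sum_(y < S.+1) \sum_(x' < S.+1) g A (y * x').
apply: (leq_trans (sum_products_le (g := G) (ltnW Sp) _)); rewrite /G.
  by rewrite big1 // => y _; rewrite big1 // => x' _; rewrite g0.
rewrite expnS expn1 -mulnA leq_mul2l big_distrr /= leq_sum ?orbT // => A _.
by apply: (sum_products_le (g := g A)); [exact: ltnW | rewrite g0 ?orbT].
Qed.

(** Sum 2 F(i) F(j) <= F(i)^2 + F(j)^2 over all pairs. *)
Lemma sqr_sum_le (T : finType) (A : {set T}) (F : T -> nat) :
  (\sum_(i in A) F i) ^ 2 <= #|A| * \sum_(i in A) F i ^ 2.
Proof.
rewrite -(leq_pmul2l (isT : 0 < 2)).
have -> : 2 * (#|A| * \sum_(i in A) F i ^ 2) =
    \sum_(i in A) \sum_(j in A) (F i ^ 2 + F j ^ 2).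
  under [RHS]eq_bigr => i _ do rewrite big_split /= sum_nat_const.
  by rewrite big_split /= sum_nat_const -big_distrr /= mul2n addnn.
rewrite expnS expn1 big_distrlr /= !big_distrr /=; apply: leq_sum => i _.
by rewrite !big_distrr /=; apply: leq_sum => j _; apply: nat_Cauchy.
Qed.

(** Cauchy-Schwarz runs over the middle vertex n, whose squared degree counts the pairs (m, m') with
    both members near n. *)
Lemma near_pairs_sqr_le p S (M : {set 'F_p}) : prime p -> S ^ 2 < p ->
  near_pairs S M ^ 2 <= #|M| * (tau p ^ 2 * J (S ^ 2) M).
Proof.
move=> p_pr Sp; rewrite /near_pairs exchange_big.
apply: leq_trans (sqr_sum_le _ _) _; rewrite leq_mul2l; apply/orP; right.
under eq_bigr => n _ do rewrite expnS expn1 big_distrlr /=.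
rewrite exchange_big J_nsol !big_distrr /=; apply: leq_sum => m mM.
rewrite exchange_big /= big_distrr /=; apply: leq_sum => m' m'M.
exact: common_neighbours_le.
Qed.

(** * From near pairs back to J, by dyadic scales *)

Local Open Scope ring_scope.

Lemma ler_natr_div (R : realFieldType) (a b : nat) :
  (a %/ b)%:R <= a%:R / b%:R :> R.
Proof.
have [->|b0] := posnP b; first by rewrite divn0 invr0 mulr0.
by rewrite ler_pdivlMr ?ltr0n // -natrM ler_nat leq_trunc_div.
Qed.

Lemma nsol_le_scale (R : realFieldType) p H m n :
  prime p -> coprime p m -> coprime p n -> (H < p)%N -> (0 < nsol p H m n)%N ->
  exists s, [/\ (0 < s)%N, (s <= H)%N, near p s m n &
    (nsol p H m n)%:R <= 4 * (H%:R ^+ 2 / p%:R) + 2 * H%:R / s%:R :> R].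
Proof.
move=> p_pr pm pn Hp /(nsol_le p_pr pm pn Hp)[s [s0 sH ns le_nsol]].
exists s; split=> //.
have P0 : 0 < p%:R :> R by rewrite ltr0n prime_gt0.
have S0 : 0 < s%:R :> R by rewrite ltr0n.
have H0 : 0 < H%:R :> R by rewrite ltr0n (leq_trans s0).
have h1 : ((2 * H * s) %/ p).+1%:R <= 2 * H%:R * s%:R / p%:R + 1 :> R.
  by rewrite -natr1 lerD2r (le_trans (ler_natr_div _ _ _)) // !natrM.
(* As s <= H, the added 1 is at most H / s. *)
have h2 : (H %/ s).+1%:R <= 2 * H%:R / s%:R :> R.
  rewrite -natr1 -mulrA mulr_natl mulr2n lerD ?ler_natr_div //.
  by rewrite ler_pdivlMr // mul1r ler_nat.
apply: (@le_trans _ _ ((2 * H%:R * s%:R / p%:R + 1) * (2 * H%:R / s%:R))).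
  apply: le_trans (ler_pM _ _ h1 h2) => //.
  by rewrite -natrM ler_nat.
rewrite le_eqVlt; apply/orP; left; apply/eqP; field.
by rewrite !gt_eqF.
Qed.

(** The scale s of [nsol_le_scale] lies between 2 ^ j and 2 ^ (j + 1) for some j < [tau p], or
    exceeds Q and is charged to the last term. Capping the scale at Q keeps it where a rate bound
    will be available. *)
Lemma nsol_le_dyadic (R : realFieldType) p H Q m n :
  prime p -> coprime p m -> coprime p n -> (H < p)%N ->
  (nsol p H m n)%:R <= 4 * (H%:R ^+ 2 / p%:R)
    + 2 * H%:R * (\sum_(j < tau p) 2 ^- j * (near p (minn (2 ^ j.+1) Q) m n)%:R)
    + (Q < H)%:R * (2 * H%:R / Q.+1%:R) :> R.
Proof.
move=> p_pr pm pn Hp.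
set X := 4 * _; set Y := \sum_(_ < _) _; set Z := 2 * _ / _.
have X0 : 0 <= X by rewrite !mulr_ge0 ?invr_ge0 ?exprn_ge0.
have Y0 : 0 <= Y by apply: sumr_ge0 => j _; rewrite mulr_ge0 ?invr_ge0 ?exprn_ge0.
have Z0 : 0 <= Z by rewrite !mulr_ge0 ?invr_ge0.
have H2 : 0 <= 2 * H%:R :> R by rewrite mulr_ge0.
have [->|n0] := posnP (nsol p H m n).
  by rewrite !addr_ge0 // mulr_ge0.
have [s [s0 sH ns le_nsol]] := nsol_le_scale R p_pr pm pn Hp n0.
apply: le_trans le_nsol _; rewrite -addrA lerD2l.
have S0 : 0 < s%:R :> R by rewrite ltr0n.
have [sQ|Qs] := leqP s Q; last first.
  rewrite (leq_trans Qs sH) mul1r -[leLHS]add0r lerD ?mulr_ge0 //.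
  by rewrite ler_wpM2l // lef_pV2 ?posrE ?ltr0n // ler_nat.
rewrite -[leLHS]addr0 lerD ?(mulr_ge0 _ Z0) //.
rewrite ler_wpM2l //.
have jt : (trunc_log 2 s < tau p)%N.
  apply: leq_ltn_trans (trunc_log2_tau (prime_gt0 p_pr)).
  by rewrite leq_trunc_log // (leq_trans sH) // ltnW.
rewrite /Y (bigD1 (Ordinal jt)) //= -[leLHS]addr0 lerD //; last first.
  by apply: sumr_ge0 => j _; rewrite mulr_ge0 ?invr_ge0 ?exprn_ge0.
rewrite (nearS _ ns) ?mulr1; last first.
  by rewrite leq_min sQ andbT ltnW // trunc_log_ltn.
by rewrite lef_pV2 ?posrE ?exprn_gt0 // -natrX ler_nat trunc_logP.
Qed.

Lemma near_pairs_le p S (M : {set 'F_p}) : (near_pairs S M <= #|M| ^ 2)%N.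
Proof.
rewrite expnS expn1 -sum_nat_const; apply: leq_sum => m _.
by rewrite -sum1_card; apply: leq_sum => n _; apply: leq_b1.
Qed.

(** The rate g controls E(S) up to Q only: each of the [tau p] dyadic scales contributes at most 2 ^
    -j g 2 ^ (j + 1) = 2 g, while beyond Q the trivial count M ^ 2 is used. *)
Lemma J_le (R : realFieldType) p H Q (M : {set 'F_p}) (g : R) :
  prime p -> 0 \notin M -> (H < p)%N -> 0 <= g ->
  (forall S, (S <= Q)%N -> (near_pairs S M)%:R <= g * S%:R) ->
  (J H M)%:R <= 4 * (H%:R ^+ 2 * #|M|%:R ^+ 2 / p%:R)
    + 4 * H%:R * (tau p)%:R * g
    + (Q < H)%:R * (2 * H%:R * #|M|%:R ^+ 2 / Q.+1%:R).
Proof.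
move=> p_pr M0 Hp g0 hg.
have cop m : m \in M -> coprime p m.
  by move=> mM; apply: Fp_coprime => //; apply: contraNneq M0 => <-.
rewrite J_nsol natr_sum.
pose B m n : R := 4 * (H%:R ^+ 2 / p%:R)
    + 2 * H%:R * (\sum_(j < tau p) 2 ^- j * (near p (minn (2 ^ j.+1) Q) m n)%:R)
    + (Q < H)%:R * (2 * H%:R / Q.+1%:R).
apply: (@le_trans _ _ (\sum_(m in M) \sum_(n in M) B m n)).
  apply: ler_sum => m mM; rewrite natr_sum; apply: ler_sum => n nM.
  by apply: nsol_le_dyadic => //; apply: cop.
have sumc (c : R) : \sum_(m in M) \sum_(n in M) c = c * #|M|%:R ^+ 2.
  by rewrite !sumr_const -mulrnA -[LHS]mulr_natr natrM.
under eq_bigr => m _ do rewrite !big_split.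
rewrite !big_split /= !sumc lerD ?lerD //.
- by rewrite -[leLHS]mulrA [_ / _ * _]mulrAC.
- under eq_bigr => m _ do rewrite -mulr_sumr exchange_big.
  rewrite -mulr_sumr exchange_big /=.
  have -> : 4 * H%:R * (tau p)%:R * g = 2 * H%:R * (\sum_(j < tau p) (2 * g)).
    by rewrite sumr_const card_ord -mulr_natr; ring.
  rewrite ler_wpM2l ?mulr_ge0 //; apply: ler_sum => j _.
  under eq_bigr => m _ do rewrite -mulr_sumr.
  rewrite -mulr_sumr.
  have -> : \sum_(m in M) \sum_(n in M) (near p (minn (2 ^ j.+1) Q) m n)%:R
     = (near_pairs (minn (2 ^ j.+1) Q) M)%:R :> R.
    by rewrite natr_sum; apply: eq_bigr => m _; rewrite natr_sum.
  rewrite ler_pdivrMl ?exprn_gt0 //.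
  apply: (le_trans (hg _ (geq_minr _ _))).
  have -> : 2 ^+ j * (2 * g) = g * (2 ^ j.+1)%:R by rewrite natrX exprS; ring.
  by rewrite ler_wpM2l // ler_nat geq_minl.
- by rewrite -[leLHS]mulrA [_ / _ * _]mulrAC.
Qed.

(** * The recursion for the rate E(S) / S *)

(** Insert [J_le] with H = S ^ 2 into the Cauchy-Schwarz bound; S ^ 2 factors out of all three
    terms. *)
Lemma near_pairs_sqr_le_real (R : realFieldType) p S Q (M : {set 'F_p}) (g : R) :
  prime p -> 0 \notin M -> (S ^ 2 < p)%N -> 0 <= g ->
  (forall S, (S <= Q)%N -> (near_pairs S M)%:R <= g * S%:R) ->
  (near_pairs S M)%:R ^+ 2 <= #|M|%:R * (tau p)%:R ^+ 2 * S%:R ^+ 2 *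
    (4 * (S%:R ^+ 2 * #|M|%:R ^+ 2 / p%:R) + 4 * (tau p)%:R * g
     + 2 * (#|M|%:R ^+ 2 / Q.+1%:R)).
Proof.
move=> p_pr M0 Sp g0 hg.
have hJ := J_le p_pr M0 Sp g0 hg.
have := near_pairs_sqr_le M p_pr Sp; rewrite -(ler_nat R) natrX => /le_trans; apply.
rewrite natrM [(_ ^ 2 * _)%:R]natrM natrX -[leRHS]mulrA -[leRHS]mulrA ler_wpM2l //.
rewrite ler_wpM2l ?exprn_ge0 //.
apply: le_trans hJ _.
set Z := 2 * _ * _ / _.
have Z0 : 0 <= Z by rewrite !mulr_ge0 ?invr_ge0 ?exprn_ge0.
apply: (@le_trans _ _ (4 * ((S ^ 2)%:R ^+ 2 * #|M|%:R ^+ 2 / p%:R) +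
  4 * (S ^ 2)%:R * (tau p)%:R * g + Z)).
  by rewrite lerD2l; case: (_ < _)%N; rewrite ?mul1r ?mul0r.
have : Q.+1%:R != 0 :> R by rewrite pnatr_eq0.
have : p%:R != 0 :> R by rewrite pnatr_eq0 -lt0n prime_gt0.
rewrite /Z !natrX le_eqVlt; move: (p%:R) Q.+1%:R => P q P0 q0.
by apply/orP; left; apply/eqP; field; rewrite P0 q0.
Qed.

(** Let g be the maximum of E(S) / S over S <= S0. At the maximising S, [near_pairs_sqr_le_real]
    bounds g in terms of itself, and S0 ^ 3 <= p turns S ^ 2 / p into at most 1 / S0. *)
Lemma growth_rate (R : realFieldType) p S0 (M : {set 'F_p}) :
  prime p -> 0 \notin M -> (0 < S0)%N -> (S0 ^ 3 <= p)%N ->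
  exists g : R, [/\ 0 <= g,
    forall S, (S <= S0)%N -> (near_pairs S M)%:R <= g * S%:R &
    g ^+ 2 <= #|M|%:R * (tau p)%:R ^+ 2
                * (6 * (#|M|%:R ^+ 2 / S0%:R) + 4 * (tau p)%:R * g)].
Proof.
move=> p_pr M0 S0_gt0 S0p.
(* At i = 0 the quotient is 0 by convention, consistent with E(0) = 0, as solutions are positive. *)
pose F (i : 'I_S0.+1) : R := (near_pairs i M)%:R / i%:R.
have [i0 _ i0max] := Order.TotalTheory.arg_maxP F (isT : predT (ord0 : 'I_S0.+1)).
have g0 : 0 <= F i0 by rewrite divr_ge0.
have hg S : (S <= S0)%N -> (near_pairs S M)%:R <= F i0 * S%:R.
  have [->|Spos SS0] := posnP S; last first.
    by rewrite -ler_pdivrMr ?ltr0n //; apply: (i0max (Ordinal (SS0 : (S < S0.+1)%N))).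
  rewrite mulr0 /near_pairs big1 // => m _; rewrite big1 // => n _.
  apply/eqP; rewrite eqb0; apply/nearP => -[x [y [+ _ /and3P[x0]]]].
  by rewrite leqNgt x0.
exists (F i0); split=> //.
have [i00|i0_gt0] := posnP i0.
  rewrite {1}/F i00 invr0 mulr0 expr0n /=.
  by rewrite !mulr_ge0 ?addr_ge0 ?mulr_ge0 ?invr_ge0 ?exprn_ge0.
have iS0 : (i0 <= S0)%N by rewrite -ltnS.
have i2p : (i0 ^ 2 < p)%N.
  apply: (@leq_ltn_trans (S0 ^ 2)); first by rewrite leq_exp2r.
  case: (S0) S0_gt0 S0p => // -[_ _|k _]; first by rewrite exp1n prime_gt1.
  by apply: leq_trans; rewrite ltn_exp2l.
have := near_pairs_sqr_le_real p_pr M0 i2p g0 hg.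
have i0R : 0 < (i0 : nat)%:R :> R by rewrite ltr0n.
rewrite {2}/F expr_div_n ler_pdivrMr ?exprn_gt0 // => /le_trans; apply.
rewrite [leLHS]mulrAC ler_wpM2r ?exprn_ge0 // ler_wpM2l //.
rewrite addrAC lerD2r.
set m := #|M|%:R.
have h1 : 2 * (m ^+ 2 / S0.+1%:R) <= 2 * (m ^+ 2 / S0%:R).
  rewrite ler_wpM2l // ler_wpM2l ?exprn_ge0 // ?ler0n // lef_pV2 ?posrE ?ltr0n //.
  by rewrite ler_nat.
have h2 : 4 * ((i0 : nat)%:R ^+ 2 * m ^+ 2 / p%:R) <= 4 * (m ^+ 2 / S0%:R).
  rewrite ler_wpM2l // [_ * m ^+ 2]mulrC -mulrA ler_wpM2l ?exprn_ge0 ?ler0n //.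
  rewrite ler_pdivrMr ?ltr0n ?prime_gt0 // mulrC ler_pdivlMr ?ltr0n //.
  rewrite -natrX -natrM ler_nat (leq_trans _ S0p) //.
  by rewrite [(S0 ^ 3)%N]expnSr leq_mul2r leq_exp2r // iS0 orbT.
by apply: le_trans (lerD h2 h1) _; rewrite -mulrDl -natrD.
Qed.

(** One of the two summands is at least half of g ^ 2; if it is the one linear in g, divide by g. *)
Lemma growth_rate_cases (R : realFieldType) (g m t u : R) :
  0 <= g -> 0 <= m -> 0 <= t -> 0 <= u ->
  g ^+ 2 <= m * t ^+ 2 * (6 * u + 4 * t * g) ->
  g <= 8 * t ^+ 3 * m \/ g ^+ 2 <= 12 * t ^+ 2 * m * u.
Proof.
move=> g0 m0 t0 u0 h.
have [h1|h1] := lerP (g ^+ 2) (12 * t ^+ 2 * m * u); [by right | left].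
have [->|gpos] := eqVneq g 0; first by rewrite !mulr_ge0 ?exprn_ge0.
have {}gpos : 0 < g by rewrite lt_def gpos.
rewrite -(ler_pM2r gpos) -expr2.
have -> : 8 * t ^+ 3 * m * g = 2 * (m * t ^+ 2 * (4 * t * g)) by ring.
move: h h1; rewrite mulrDr.
have -> : 12 * t ^+ 2 * m * u = 2 * (m * t ^+ 2 * (6 * u)) by ring.
by lra.
Qed.

(** * The factor p^o(1) *)

(** By [tau_le], tau ^ k <= C p <= p ^ 2 once p >= C, so ln tau <= (2 / k) ln p; any k >= 2 e / eps
    suffices. *)
Lemma tau_p_to_o1 (R : realType) (e : nat) :
  is_p_to_o1 (fun p => (tau p)%:R ^+ e : R).
Proof.
have tau1 p : 1 <= (tau p)%:R :> R by rewrite ler1n tau_gt0.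
have tau0 p : 0 < (tau p)%:R :> R by rewrite ltr0n tau_gt0.
split; first by apply: nearW => p; rewrite expf_neq0 // gt_eqF.
rewrite /primes_oo; apply: cvg_within_filter.
apply/cvgrPdist_le => eps eps0.
pose k := (Num.truncn (2 * e%:R / eps : R)).+1.
have k0 : 0 < k%:R :> R by rewrite ltr0n.
have ke : 2 * e%:R <= eps * k%:R.
  by rewrite [leRHS]mulrC -ler_pdivrMr // ltW // truncnS_gt.
pose C := ((k ^ k) ^ (2 ^ k))%N.
near=> p.
have pC : (maxn 2 C <= p)%N by near: p; exists (maxn 2 C).
move: pC; rewrite geq_max => /andP[p2 pC].
have lnp0 : 0 < ln p%:R :> R by rewrite ln_gt0 // ltr1n.
have lnt0 : 0 <= ln (tau p)%:R :> R by rewrite ln_ge0.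
rewrite sub0r normrN [`|_ ^+ e|]ger0_norm ?exprn_ge0 // lnXn //.
rewrite ger0_norm; last by rewrite divr_ge0 ?mulrn_wge0 // ltW.
rewrite ler_pdivrMr //.
have h : k%:R * ln (tau p)%:R <= 2 * ln p%:R :> R.
  rewrite !mulr_natl -!lnXn ?ltr0n ?tau_gt0 ?(ltnW p2) //.
  rewrite ler_ln ?posrE ?exprn_gt0 ?ltr0n ?tau_gt0 ?(ltnW p2) //.
  rewrite -!natrX ler_nat (leq_trans (tau_le _ _)) ?(ltnW p2) //.
  by rewrite expnS expn1 leq_mul2r -/C pC orbT.
suff : k%:R * (ln (tau p)%:R *+ e) <= k%:R * (eps * ln p%:R) :> R.
  by rewrite ler_pM2l.
rewrite -[ln _ *+ e]mulr_natl mulrCA.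
apply: (le_trans (ler_wpM2l _ h)) => //.
rewrite [leLHS]mulrCA [leLHS]mulrA [leRHS]mulrCA [leRHS]mulrA.
by rewrite ler_wpM2r // ltW.
Unshelve. all: by end_near.
Qed.

(** * Roots, and the three ranges of H and M *)

Lemma nat_root k n : (0 < k)%N -> exists s, (s ^ k <= n < s.+1 ^ k)%N.
Proof.
move=> k0; elim: n => [|n [s /andP[h1 h2]]]; first by exists 0%N; rewrite exp0n ?exp1n.
have [h|h] := ltnP n.+1 (s.+1 ^ k); first by exists s; rewrite h (leqW h1).
exists s.+1; rewrite h /=; apply: leq_ltn_trans h2 _.
by rewrite ltn_exp2r.
Qed.

Lemma powR_natmul (R : realType) (x a b : R) n : 0 <= x -> a * n%:R = b ->
  (x `^ a) ^+ n = x `^ b.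
Proof. by move=> x0 <-; rewrite powRrM powR_mulrn ?powR_ge0. Qed.

Lemma ler_sqr_imp (R : realFieldType) (x y : R) : 0 <= y -> x ^+ 2 <= y ^+ 2 -> x <= y.
Proof.
move=> y0 h; have [x0|/ltW x0] := lerP 0 x; last exact: le_trans y0.
by rewrite -(@ler_pXn2r _ 2) ?nnegrE.
Qed.

(* The rate is at most tau^3 M up to M ~ p^(1/3), and at most
   tau (M^3 / p^(1/3))^(1/2) beyond; here u stands for p^(1/3). *)
Lemma growth_rate_cbrt (R : realFieldType) p (M : {set 'F_p}) (u : R) :
  prime p -> 0 \notin M -> 0 < u -> u ^+ 3 = p%:R ->
  exists Q (g : R), [/\ u <= Q.+1%:R, 0 <= g,
    forall S, (S <= Q)%N -> (near_pairs S M)%:R <= g * S%:R &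
    g <= 8 * (tau p)%:R ^+ 3 * #|M|%:R
    \/ g ^+ 2 <= 24 * (tau p)%:R ^+ 2 * #|M|%:R ^+ 3 / u].
Proof.
move=> p_pr M0 u0 up.
have [S0 /andP[h1 h2]] := @nat_root 3 p isT.
have S0_gt0 : (0 < S0)%N.
  case: S0 h1 h2 => // _; rewrite exp1n => p1.
  by move: (prime_gt1 p_pr); rewrite ltnNge -ltnS (leq_trans p1).
have [g [g0 hg gsq]] := growth_rate R p_pr M0 S0_gt0 h1.
have u_lt : u <= S0.+1%:R.
  rewrite -(@ler_pXn2r _ 3) ?nnegrE ?ltW // up -natrX ltr_nat.
  exact: h2.
have sR : 0 < S0%:R :> R by rewrite ltr0n.
(* Rounding the cube root down loses at most a factor 2, which turns 12 into 24. *)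
have u2 : u <= 2 * S0%:R.
  apply: le_trans u_lt _; rewrite -natrM ler_nat; lia.
exists S0, g; split=> //.
have m0 : 0 <= #|M|%:R :> R by [].
have t0 : 0 <= (tau p)%:R :> R by [].
have v0 : 0 <= #|M|%:R ^+ 2 / S0%:R :> R by rewrite divr_ge0 ?exprn_ge0.
have [h|h] := growth_rate_cases g0 m0 t0 v0 gsq; [by left | right].
apply: le_trans h _.
have -> : 12 * (tau p)%:R ^+ 2 * #|M|%:R * (#|M|%:R ^+ 2 / S0%:R)
  = 12 * (tau p)%:R ^+ 2 * #|M|%:R ^+ 3 * S0%:R^-1 :> R by ring.
have -> : 24 * (tau p)%:R ^+ 2 * #|M|%:R ^+ 3 / u
  = 12 * (tau p)%:R ^+ 2 * #|M|%:R ^+ 3 * (2 / u) :> R by ring.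
rewrite ler_wpM2l ?mulr_ge0 ?exprn_ge0 //.
by rewrite ler_pdivlMr // mulrC ler_pdivrMr.
Qed.

(** With u = p^(1/3) and H >= u ^ 2, the cost H M ^ 2 / u of the scales beyond Q is at most H ^ 2 M
    ^ 2 / p. *)
Lemma J_le_large_H (R : realFieldType) p H (M : {set 'F_p}) (u : R) :
  prime p -> 0 \notin M -> (H < p)%N -> 0 < u -> u ^+ 3 = p%:R ->
  u ^+ 2 <= H%:R ->
  (J H M)%:R <= 200 * (H%:R ^+ 2 * #|M|%:R ^+ 2 / p%:R
                       + H%:R * #|M|%:R * (tau p)%:R ^+ 4) :> R.
Proof.
move=> p_pr M0 Hp u0 up uH.
have [Q [g [uQ g0 hg gcase]]] := growth_rate_cbrt p_pr M0 u0 up.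
have := J_le p_pr M0 Hp g0 hg.
set X := H%:R ^+ 2 * _ / _; set Z := 2 * _ * _ / _.
have Z0 : 0 <= Z by rewrite !mulr_ge0 ?invr_ge0 ?exprn_ge0.
have {Z0} : (Q < H)%:R * Z <= Z.
  by case: (Q < H)%N; rewrite ?mul1r ?mul0r.
have hu : H%:R * (#|M|%:R ^+ 2 / u) <= X.
  have -> : X = H%:R * #|M|%:R ^+ 2 * (H%:R / u ^+ 3) by rewrite /X -up; ring.
  rewrite [leLHS]mulrA ler_wpM2l ?mulr_ge0 ?exprn_ge0 // ler_pdivlMr ?exprn_gt0 //.
  by have -> : u^-1 * u ^+ 3 = u ^+ 2 by field; rewrite gt_eqF.
have hZ : Z <= 2 * X.
  apply: (@le_trans _ _ (2 * (H%:R * (#|M|%:R ^+ 2 / u)))); last by rewrite ler_wpM2l.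
  rewrite /Z -[2 * _ * _]mulrA -[leLHS]mulrA -[X in 2 * X <= _]mulrA.
  rewrite ler_wpM2l // ler_wpM2l // ler_wpM2l ?exprn_ge0 //.
  by rewrite lef_pV2 ?posrE ?ltr0n.
(* In the second case the square of the left side is at most the product of the two summands, hence
   at most the square of their sum. *)
have hg2 : (tau p)%:R * g <= 24 * (tau p)%:R ^+ 4 * #|M|%:R + #|M|%:R ^+ 2 / u.
  have [m0 t0] : 0 <= #|M|%:R :> R /\ 0 <= (tau p)%:R :> R by [].
  have v0 : 0 <= #|M|%:R ^+ 2 / u by rewrite divr_ge0 ?exprn_ge0 // ltW.
  have a0 : 0 <= 24 * (tau p)%:R ^+ 4 * #|M|%:R :> R by rewrite !mulr_ge0 ?exprn_ge0.
  case: gcase => hgc.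
    have : (tau p)%:R * g <= (tau p)%:R * (8 * (tau p)%:R ^+ 3 * #|M|%:R).
      by rewrite ler_wpM2l.
    have -> : (tau p)%:R * (8 * (tau p)%:R ^+ 3 * #|M|%:R) =
      8 * ((tau p)%:R ^+ 4 * #|M|%:R) :> R by ring.
    move: a0 v0; rewrite -[24 * _ * _]mulrA.
    move: (_ ^+ 4 * _) (_ / u) (_ * g) => a b c; lra.
  apply: ler_sqr_imp; first exact: addr_ge0.
  apply: (@le_trans _ _ (24 * (tau p)%:R ^+ 4 * #|M|%:R * (#|M|%:R ^+ 2 / u))).
    rewrite exprMn.
    apply: (@le_trans _ _ ((tau p)%:R ^+ 2 * (24 * (tau p)%:R ^+ 2 * #|M|%:R ^+ 3 / u))).
      by rewrite ler_wpM2l ?exprn_ge0.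
    by rewrite le_eqVlt; apply/orP; left; apply/eqP; ring.
  by move: a0 v0; move: (24 * _ * _) (_ / u) => a b; nra.
have : H%:R * ((tau p)%:R * g) <=
  H%:R * (24 * (tau p)%:R ^+ 4 * #|M|%:R) + H%:R * (#|M|%:R ^+ 2 / u).
  by rewrite -mulrDr ler_wpM2l.
have X0 : 0 <= X by rewrite !mulr_ge0 ?invr_ge0 ?exprn_ge0.
have Y0 : 0 <= H%:R * #|M|%:R * (tau p)%:R ^+ 4 :> R.
  by rewrite !mulr_ge0 ?exprn_ge0.
have -> : H%:R * (24 * (tau p)%:R ^+ 4 * #|M|%:R) =
  24 * (H%:R * #|M|%:R * (tau p)%:R ^+ 4) :> R by ring.
have -> : 4 * H%:R * (tau p)%:R * g = 4 * (H%:R * ((tau p)%:R * g)) by ring.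
move: X0 Y0 hu hZ.
move: (_ * (_ ^+ 2 / u)) (_ * _ * _ ^+ 4) (H%:R * (_ * g)) => a b c.
clearbody X Z; move: (_ * Z) => d; move: (J H M)%:R => j; lra.
Qed.

(** For M <= u everything is absorbed by H M: M ^ 3 / u <= M ^ 2 in the rate, H M <= u ^ 3 = p in
    the main term, and M ^ 2 / u <= M beyond Q. *)
Lemma J_le_small_M (R : realFieldType) p H (M : {set 'F_p}) (u : R) :
  prime p -> 0 \notin M -> (H < p)%N -> 0 < u -> u ^+ 3 = p%:R ->
  H%:R <= u ^+ 2 -> #|M|%:R <= u ->
  (J H M)%:R <= 200 * (H%:R * #|M|%:R * (tau p)%:R ^+ 4) :> R.
Proof.
move=> p_pr M0 Hp u0 up Hu Mu.
have [Q [g [uQ g0 hg gcase]]] := growth_rate_cbrt p_pr M0 u0 up.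
have := J_le p_pr M0 Hp g0 hg.
have T1 : 1 <= (tau p)%:R :> R by rewrite ler1n tau_gt0.
have [m0 t0] : 0 <= #|M|%:R :> R /\ 0 <= (tau p)%:R :> R by [].
have T4 : 1 <= (tau p)%:R ^+ 4 :> R by rewrite exprn_ege1.
have g_le : g <= 8 * (tau p)%:R ^+ 3 * #|M|%:R.
  case: gcase => // h; apply: ler_sqr_imp; first by rewrite !mulr_ge0 ?exprn_ge0.
  apply: le_trans h _; rewrite ler_pdivrMr //.
  apply: (@le_trans _ _ (64 * (tau p)%:R ^+ 6 * #|M|%:R ^+ 2 * #|M|%:R)).
    rewrite -[leRHS]mulrA -[_ ^+ 2 * #|M|%:R]exprSr ler_wpM2r ?exprn_ge0 //.
    by rewrite ler_pM ?exprn_ge0 // ?ler_nat // ler_weXn2l.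
  have -> : (8 * (tau p)%:R ^+ 3 * #|M|%:R) ^+ 2 =
    64 * (tau p)%:R ^+ 6 * #|M|%:R ^+ 2 :> R by ring.
  by rewrite ler_wpM2l ?mulr_ge0 ?exprn_ge0.
set Z := 2 * _ * _ / _.
have Z0 : 0 <= Z by rewrite !mulr_ge0 ?invr_ge0 ?exprn_ge0.
have {Z0} : (Q < H)%:R * Z <= Z.
  by case: (Q < H)%N; rewrite ?mul1r ?mul0r.
have hM : H%:R * #|M|%:R <= H%:R * #|M|%:R * (tau p)%:R ^+ 4 :> R.
  by rewrite ler_peMr ?mulr_ge0.
have hZ : Z <= 2 * (H%:R * #|M|%:R).
  rewrite /Z ler_pdivrMr ?ltr0n // expr2 -!mulrA ler_wpM2l // ler_wpM2l //.
  by rewrite ler_wpM2l // (le_trans Mu).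
have hX : H%:R ^+ 2 * #|M|%:R ^+ 2 / p%:R <= H%:R * #|M|%:R :> R.
  rewrite ler_pdivrMr ?ltr0n ?prime_gt0 // -exprMn expr2 ler_wpM2l ?mulr_ge0 //.
  by rewrite -up exprSr ler_pM.
have hG : 4 * H%:R * (tau p)%:R * g <= 32 * (H%:R * #|M|%:R * (tau p)%:R ^+ 4).
  have -> : 32 * (H%:R * #|M|%:R * (tau p)%:R ^+ 4) =
    4 * H%:R * (tau p)%:R * (8 * (tau p)%:R ^+ 3 * #|M|%:R) :> R by ring.
  by rewrite ler_wpM2l ?mulr_ge0.
have e0 : 0 <= H%:R * #|M|%:R :> R by rewrite mulr_ge0.
move: e0 hM hZ hX hG; clearbody Z.
move: (H%:R * #|M|%:R * (tau p)%:R ^+ 4 : R) (H%:R * #|M|%:R : R) => d e.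
move: (_ / p%:R) (_ * g) ((Q < H)%:R * Z) (J H M)%:R => a b c j; lra.
Qed.

(* With t = p^(1/12) and w = M^(1/4), the quantity w^7 / t^3 is
   M^(7/4) p^(-1/4): the geometric mean of the trivial bound M^2 / S and of
   the Cauchy-Schwarz bound M^(3/2) S / p^(1/2). *)
Lemma near_pairs_le_sqrt (R : realFieldType) p S (M : {set 'F_p}) (t w : R) :
  prime p -> 0 \notin M -> 0 < t -> t ^+ 12 = p%:R ->
  t <= w -> w ^+ 4 = #|M|%:R -> (S ^ 2 < p)%N ->
  (near_pairs S M)%:R <= 8 * (tau p)%:R ^+ 3 * (w ^+ 7 / t ^+ 3) * S%:R.
Proof.
move=> p_pr M0 t0 tp tw wm Sp; set K := w ^+ 7 / t ^+ 3; set T := (tau p)%:R.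
have w0 : 0 < w by apply: lt_le_trans tw.
have [tge0 wge0] : 0 <= t /\ 0 <= w by rewrite !ltW.
have T1 : 1 <= T by rewrite ler1n tau_gt0.
have T0 : 0 <= T by [].
have K0 : 0 <= K by rewrite divr_ge0 ?exprn_ge0.
have G0 : 0 <= 8 * T ^+ 3 * K by apply: mulr_ge0 => //; rewrite mulr_ge0 ?exprn_ge0.
(* Here M >= p^(1/3) enters, as t <= w: it gives M <= K. *)
have wK : w ^+ 4 <= K.
  rewrite /K ler_pdivlMr ?exprn_gt0 // [w ^+ 7](exprD w 4 3) ler_wpM2l ?exprn_ge0 //.
  by rewrite ler_pXn2r ?nnegrE.
have u0 : 0 < t ^+ 4 by rewrite exprn_gt0.
have up : (t ^+ 4) ^+ 3 = p%:R by rewrite -exprM.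
have [Q [g [uQ g0 hg gcase]]] := growth_rate_cbrt p_pr M0 u0 up.
have g_le : g <= 8 * T ^+ 3 * K.
  case: gcase => h.
    by apply: le_trans h _; rewrite -wm ler_wpM2l ?mulr_ge0 ?exprn_ge0.
  apply: ler_sqr_imp => //.
  apply: le_trans h _; rewrite -wm -/T.
  have -> : (8 * T ^+ 3 * K) ^+ 2 = 64 * T ^+ 6 * (w ^+ 14 / t ^+ 6).
    by rewrite /K; field; rewrite gt_eqF.
  rewrite -[leLHS]mulrA ler_pM ?mulr_ge0 ?exprn_ge0 ?invr_ge0 ?exprn_ge0 //.
    by rewrite ler_pM ?exprn_ge0 // ?ler_nat // ler_weXn2l.
  rewrite -exprM ler_pdivrMr // mulrAC ler_pdivlMr ?exprn_gt0 //.
  rewrite [w ^+ 14](exprD w 12 2) [t ^+ 6](exprD t 2 4) -[leRHS]mulrA.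
  rewrite ler_wpM2l ?exprn_ge0 // ler_wpM2r ?exprn_ge0 //.
  by rewrite ler_pXn2r ?nnegrE.
have [SQ|QS] := leqP S Q.
  by apply: le_trans (hg _ SQ) _; rewrite ler_wpM2r.
have uS : t ^+ 4 <= S%:R by apply: le_trans uQ _; rewrite ler_nat.
have := near_pairs_sqr_le_real p_pr M0 Sp g0 hg.
have := near_pairs_le S M; rewrite -(ler_nat R) natrX -wm -/T.
have E0 : 0 <= (near_pairs S M)%:R :> R by [].
have s0 : 0 <= S%:R :> R by [].
set E := (near_pairs S M)%:R; set s := S%:R; set A := s ^+ 2 * _ / _.
move=> E_le h.
have A0 : 0 <= A by rewrite !mulr_ge0 ?invr_ge0 ?exprn_ge0.
(* Now S >= p^(1/3), so 1 / (Q + 1) <= p^(-1/3) <= S ^ 2 / p. *)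
have hQ : (w ^+ 4) ^+ 2 / Q.+1%:R <= A.
  rewrite /A [s ^+ 2 * _]mulrC -[leRHS]mulrA ler_wpM2l ?exprn_ge0 //.
  apply: (@le_trans _ _ (t ^+ 4)^-1); first by rewrite lef_pV2 ?posrE ?ltr0n.
  rewrite -tp ler_pdivlMr ?exprn_gt0 //.
  have -> : (t ^+ 4)^-1 * t ^+ 12 = (t ^+ 4) ^+ 2 by field; rewrite gt_eqF.
  by rewrite ler_pXn2r ?nnegrE // ltW.
have B0 : 0 <= w ^+ 4 * T ^+ 2 * s ^+ 2 by rewrite !mulr_ge0 ?exprn_ge0.
have {}h : E ^+ 2 <= w ^+ 4 * T ^+ 2 * s ^+ 2 * (6 * A + 4 * T * g).
  apply: le_trans h _; rewrite ler_wpM2l //.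
  by move: hQ; move: (_ / Q.+1%:R) (4 * T * g) => x y; lra.
(* If the term in g dominates, M <= K and g <= 8 T^3 K give E <= 8 T^3 K S directly. *)
have [hA|hA] := lerP (4 * T * g) (6 * A); last first.
  apply: ler_sqr_imp; first by rewrite (mulr_ge0 G0).
  apply: le_trans h _.
  apply: (@le_trans _ _ (w ^+ 4 * T ^+ 2 * s ^+ 2 * (8 * T * g))).
    by rewrite ler_wpM2l //; move: (T * g) hA => ? ?; lra.
  apply: (@le_trans _ _ (K * T ^+ 2 * s ^+ 2 * (8 * T * (8 * T ^+ 3 * K)))).
    apply: ler_pM => //; first by rewrite !mulr_ge0.
      by rewrite ler_wpM2r ?exprn_ge0 // ler_wpM2r ?exprn_ge0.
    by rewrite ler_wpM2l ?mulr_ge0.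
  by rewrite le_eqVlt; apply/orP; left; apply/eqP; ring.
(* Otherwise E ^ 2 <= 12 T^2 M^3 S^4 / p; times the trivial E ^ 2 <= M ^ 4 this is 12 T^2 (K S)^4,
   because K ^ 4 = M ^ 7 / p. *)
rewrite -(@ler_pXn2r _ 4) ?nnegrE ?(mulr_ge0 G0) //.
have -> : E ^+ 4 = E ^+ 2 * E ^+ 2 by ring.
apply: (@le_trans _ _ (((w ^+ 4) ^+ 2) ^+ 2 * (w ^+ 4 * T ^+ 2 * s ^+ 2 * (12 * A)))).
  apply: ler_pM; rewrite ?exprn_ge0 //.
    by rewrite ler_pXn2r ?nnegrE ?exprn_ge0.
  by apply: le_trans h _; rewrite ler_wpM2l //; lra.
have -> : ((w ^+ 4) ^+ 2) ^+ 2 * (w ^+ 4 * T ^+ 2 * s ^+ 2 * (12 * A)) =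
    12 * T ^+ 2 * (K * s) ^+ 4.
  by rewrite /A /K -tp; field; rewrite gt_eqF.
have -> : (8 * T ^+ 3 * K * s) ^+ 4 = 4096 * T ^+ 12 * (K * s) ^+ 4 by ring.
have ks0 : 0 <= (K * s) ^+ 4 by rewrite exprn_ge0 // (mulr_ge0 K0).
rewrite ler_wpM2r //.
by rewrite ler_pM ?exprn_ge0 // ?ler_nat // ler_weXn2l.
Qed.

(** Cut at U, the integer part of p^(1/2), the reach of [near_pairs_le_sqrt]. When U < H, p < (U +
    1)^2 <= (U + 1) H, so the larger scales cost at most a multiple of the main term. *)
Lemma J_le_large_M (R : realFieldType) p H (M : {set 'F_p}) (t w : R) :
  prime p -> 0 \notin M -> (H < p)%N -> 0 < t -> t ^+ 12 = p%:R ->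
  t <= w -> w ^+ 4 = #|M|%:R ->
  (J H M)%:R <= 200 * (H%:R ^+ 2 * #|M|%:R ^+ 2 / p%:R
                       + H%:R * w ^+ 7 * ((t ^+ 3)^-1 * (tau p)%:R ^+ 4)).
Proof.
move=> p_pr M0 Hp t0 tp tw wm; set K := w ^+ 7 / t ^+ 3.
have [U /andP[U1 U2]] := @nat_root 2 p isT.
have w0 : 0 < w by apply: lt_le_trans tw.
have [tge0 wge0] : 0 <= t /\ 0 <= w by rewrite !ltW.
have K0 : 0 <= K by rewrite divr_ge0 ?exprn_ge0.
(* A prime is not a square, so the inequality is strict. *)
have U2p : (U ^ 2 < p)%N.
  rewrite ltn_neqAle U1 andbT; apply: contraTneq p_pr => <-.
  rewrite expnS expn1; case: U {U1 U2} => [|[|U]] //.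
  by apply/primePn; right; exists U.+2; rewrite ?dvdn_mulr // ltn_Pmull.
have hg S : (S <= U)%N -> (near_pairs S M)%:R <= 8 * (tau p)%:R ^+ 3 * K * S%:R.
  move=> SU; apply: near_pairs_le_sqrt => //.
  by apply: leq_ltn_trans U2p; rewrite leq_exp2r.
have g0 : 0 <= 8 * (tau p)%:R ^+ 3 * K.
  by apply: mulr_ge0 => //; rewrite mulr_ge0 ?exprn_ge0.
have := J_le p_pr M0 Hp g0 hg.
set X := H%:R ^+ 2 * _ / _.
have X0 : 0 <= X by rewrite !mulr_ge0 ?invr_ge0 ?exprn_ge0.
have hZ : (U < H)%:R * (2 * H%:R * #|M|%:R ^+ 2 / U.+1%:R) <= 2 * X.
  have [UH|_] := ltnP U H; last by rewrite mul0r mulr_ge0.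
  rewrite mul1r.
  have -> : 2 * X = 2 * H%:R * #|M|%:R ^+ 2 * (H%:R / p%:R) by rewrite /X; ring.
  rewrite ler_wpM2l ?mulr_ge0 ?exprn_ge0 //.
  rewrite ler_pdivlMr ?ltr0n ?prime_gt0 // mulrC ler_pdivrMr ?ltr0n //.
  by rewrite -natrM ler_nat (leq_trans (ltnW U2)) // expnS expn1 leq_mul2r UH orbT.
have -> : H%:R * w ^+ 7 * ((t ^+ 3)^-1 * (tau p)%:R ^+ 4) =
  H%:R * (tau p)%:R ^+ 4 * K by rewrite /K; ring.
have -> : 4 * H%:R * (tau p)%:R * (8 * (tau p)%:R ^+ 3 * K) =
  32 * (H%:R * (tau p)%:R ^+ 4 * K) by ring.
have Y0 : 0 <= H%:R * (tau p)%:R ^+ 4 * K.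
  by apply: mulr_ge0 => //; rewrite mulr_ge0 ?exprn_ge0.
move: X0 Y0 hZ; clearbody X; move: (H%:R * (tau p)%:R ^+ 4 * K) => y.
move: ((U < H)%:R * _) (J H M)%:R => v j; lra.
Qed.

Theorem theorem2p1 (R : realType) :
  exists (c : R) (f : nat -> R),
    [/\ 0 < c, is_p_to_o1 f &
    forall (p H : nat) (M : {set 'F_p}),
      prime p -> (1 <= H < p)%N -> 0 \notin M ->
      [/\ (p%:R : R) `^ (2 / 3) <= H%:R ->
            (J H M)%:R <=
              c * (H%:R ^+ 2 * #|M|%:R ^+ 2 / p%:R + H%:R * #|M|%:R * f p),
          H%:R < (p%:R : R) `^ (2 / 3) -> (p%:R : R) `^ (1 / 3) <= #|M|%:R ->
            (J H M)%:R <=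
              c * (H%:R ^+ 2 * #|M|%:R ^+ 2 / p%:R
                   + H%:R * #|M|%:R `^ (7 / 4) * (p%:R `^ (- (1 / 4)) * f p)
                   + #|M|%:R ^+ 2)
        & H%:R < (p%:R : R) `^ (2 / 3) -> #|M|%:R < (p%:R : R) `^ (1 / 3) ->
            (J H M)%:R <= c * (H%:R * #|M|%:R * f p + #|M|%:R ^+ 2)]].
Proof.
(* The exponent 4 is one [tau p] for the dyadic scales and three for the rate. The largest constant
   arising in the three ranges is 96 = 4 * 24. *)
exists 200, (fun p => (tau p)%:R ^+ 4); split=> //; first exact: tau_p_to_o1.
move=> p H M p_pr /andP[_ Hp] M0.
have P0 : 0 <= p%:R :> R by [].
have Pgt0 : 0 < p%:R :> R by rewrite ltr0n prime_gt0.
(* A twelfth root makes p^(1/3), p^(2/3) and p^(1/4) natural powers of t. *)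
set t := p%:R `^ (1 / 12) : R.
have t0 : 0 < t by apply: powR_gt0.
have tE n b : 1 / 12 * n%:R = b -> t ^+ n = p%:R `^ b by apply: powR_natmul.
have -> : p%:R `^ (2 / 3) = t ^+ 8 by rewrite (tE _ (2 / 3)) //; field.
have -> : p%:R `^ (1 / 3) = t ^+ 4 by rewrite (tE _ (1 / 3)) //; field.
have tp : t ^+ 12 = p%:R by rewrite (tE _ 1) ?powRr1 //; field.
have u0 : 0 < t ^+ 4 by rewrite exprn_gt0.
have up : (t ^+ 4) ^+ 3 = p%:R by rewrite -exprM.
have u2 : t ^+ 8 = (t ^+ 4) ^+ 2 by rewrite -exprM.
split=> [tH|Ht tM|Ht Mt].
- by apply: (J_le_large_H p_pr M0 Hp u0 up); rewrite -u2.
- set w := #|M|%:R `^ (1 / 4) : R.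
  have m0 : 0 <= #|M|%:R :> R by [].
  have wE n b : 1 / 4 * n%:R = b -> w ^+ n = #|M|%:R `^ b by apply: powR_natmul.
  have wm : w ^+ 4 = #|M|%:R by rewrite (wE _ 1) ?powRr1 //; field.
  have -> : #|M|%:R `^ (7 / 4) = w ^+ 7 by rewrite (wE _ (7 / 4)) //; field.
  have -> : p%:R `^ (- (1 / 4)) = (t ^+ 3)^-1.
    by rewrite powRN (tE _ (1 / 4)) //; field.
  have tw : t <= w by rewrite -(@ler_pXn2r _ 4) ?nnegrE ?powR_ge0 // wm.
  apply: le_trans (J_le_large_M p_pr M0 Hp t0 tp tw wm) _.
  by rewrite ler_wpM2l // lerDl exprn_ge0.
- apply: le_trans (J_le_small_M p_pr M0 Hp u0 up _ (ltW Mt)) _.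
    by rewrite -u2 ltW.
  by rewrite ler_wpM2l // lerDl exprn_ge0.
Qed.
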